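(* Let $\mathcal{C}$ be a clutter with a perfect matching $e_1,\ldots,e_g$ of König type. If $\mathcal{C}$ has no cycles of length $3$ or $4$ and $\mathcal{C}$ is unmixed, then for any two edges $f_1,f_2$ of $\mathcal{C}$ and for any $e_i$, one has $f_1\cap e_i\subset f_2\cap e_i$ or $f_2\cap e_i\subset f_1\cap e_i$.
   Context: A clutter $\mathcal{C}$ with finite vertex set $X=\{x_1,\ldots,x_n\}$ is a family $E(\mathcal{C})$ of subsets of $X$, called edges, none of which is included in another. The edge ideal $I(\mathcal{C})$ is the ideal of the polynomial ring $R=K[x_1,\ldots,x_n]$ over a field $K$ generated by the monomials $\prod_{x_i\in e}x_i$, $e\in E(\mathcal{C})$. A vertex cover of $\mathcal{C}$ is a subset of $X$ meeting every edge; it is minimal if no proper subset is a vertex cover. The height of $I(\mathcal{C})$ equals the minimum size of a vertex cover. $\mathcal{C}$ is unmixed if all its minimal vertex covers have the same size. A perfect matching of König type of $\mathcal{C}$ is a collection $e_1,\ldots,e_g$ of pairwise disjoint edges whose union is $X$ and such that $g$ is the height of $I(\mathcal{C})$. The incidence matrix of $\mathcal{C}$, with edges $g_1,\ldots,g_q$, is $A=(a_{ij})$ with $a_{ij}=1$ if $x_i\in g_j$ and $a_{ij}=0$ otherwise. $\mathcal{C}$ has a cycle of length $r$ (where $r\geq 3$) if there is a square submatrix of $A$ of order $r$ with exactly two $1$'s in each row and column. The symbol $\subset$ allows equality. *)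

(* Defs.v *)
From HB Require Import structures.
From mathcomp Require Import all_boot all_order all_algebra.
From mathcomp Require Import mpoly.

Set Implicit Arguments.
Unset Strict Implicit.
Unset Printing Implicit Defensive.

Import GRing.Theory.
Local Open Scope ring_scope.

(* Ideals are Prop-valued predicates: the boolean ones of ring_quotient only
   cover ideals with decidable membership, and the height quantifies over all
   prime ideals. *)
Section Height.
Variable R : comNzRingType.

Definition ideal (I : R -> Prop) : Prop :=
  [/\ I 0, forall u v, I u -> I v -> I (u + v) & forall a u, I u -> I (a * u)].

Definition prime_ideal (P : R -> Prop) : Prop :=
  [/\ ideal P, ~ P 1 & forall u v, P (u * v) -> P u \/ P v].

Definition subideal (I J : R -> Prop) : Prop := forall u, I u -> J u.

(* A strict chain Q 0 < ... < Q m = P of prime ideals, of length m; the values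
   of Q beyond m are irrelevant. *)
Definition prime_chain (P : R -> Prop) (m : nat) : Prop :=
  exists Q : nat -> R -> Prop,
    [/\ forall k, (k <= m)%N -> prime_ideal (Q k),
        forall k, (k < m)%N ->
          subideal (Q k) (Q k.+1) /\ ~ subideal (Q k.+1) (Q k)
      & forall u, Q m u <-> P u].

Definition prime_height (P : R -> Prop) (h : nat) : Prop :=
  prime_chain P h /\ forall m, prime_chain P m -> (m <= h)%N.

(* The height of I is h when h is the least height of a prime containing I.
   In the second clause, the chain says that P has height at least h, possibly
   infinite.  The unit ideal has no height. *)
Definition height (I : R -> Prop) (h : nat) : Prop :=
  (exists P, [/\ prime_ideal P, subideal I P & prime_height P h]) /\
  (forall P, prime_ideal P -> subideal I P -> prime_chain P h).

End Height.

Record clutter (n : nat) := Clutter {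
  edges : {set {set 'I_n}};
  edges_antichain : forall e f, e \in edges -> f \in edges -> e \subset f -> e = f
}.

Section Clutter.
Variables (n : nat) (C : clutter n).

Definition edge_monomial (K : fieldType) (e : {set 'I_n}) : {mpoly K[n]} :=
  \prod_(i in e) 'X_i.

Definition edge_ideal (K : fieldType) (p : {mpoly K[n]}) : Prop :=
  exists a : {set 'I_n} -> {mpoly K[n]},
    p = \sum_(e in edges C) a e * edge_monomial K e.

Definition vertex_cover (S : {set 'I_n}) : bool :=
  [forall e in edges C, S :&: e != set0].

Definition minimal_vertex_cover (S : {set 'I_n}) : bool :=
  minset vertex_cover S.

Definition unmixed : Prop :=
  forall S T, minimal_vertex_cover S -> minimal_vertex_cover T ->
    #|S| = #|T|.

Definition konig_perfect_matching (K : fieldType) (g : nat)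
    (e : 'I_g -> {set 'I_n}) : Prop :=
  [/\ forall i, e i \in edges C,
      forall i j, i != j -> [disjoint e i & e j],
      \bigcup_i e i = [set: 'I_n]
    & height (@edge_ideal K) g].

Definition incidence_mx : 'M[int]_(n, #|edges C|) :=
  \matrix_(i, j) (i \in (enum_val j : {set 'I_n}))%:R.

(* The selections of rows and columns need not be increasing, as the condition
   is invariant under permutations of rows and columns. *)
Definition has_cycle (r : nat) : Prop :=
  (3 <= r)%N /\
  exists (s : 'I_r -> 'I_n) (t : 'I_r -> 'I_#|edges C|),
    [/\ injective s, injective t,
        forall i, #|[set j | mxsub s t incidence_mx i j == 1]| = 2%N
      & forall j, #|[set i | mxsub s t incidence_mx i j == 1]| = 2%N].

End Clutter.

(* Main.v *)
Require Import Defs.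
From mathcomp Require Import all_boot all_order all_algebra.
From mathcomp Require Import mpoly.
From Stdlib Require Import Classical.

(** Two facts carry the proof: a perfect matching of König type rigidifies the
minimal vertex covers, and this rigidity produces a fourth edge which closes
up a short cycle.

Rigidity.  If [P] is a prime of height [g] containing the edge ideal, the
vertices whose variables lie in [P] form a vertex cover [S].  The primes
generated by initial segments of [S], with [P] itself on top, form a chain of
length [#|S|], so [#|S| <= g] ([cover_of_height]).  As the [g] disjoint edges of
the matching need [g] different vertices to be covered, unmixedness forces
every minimal vertex cover to have exactly [g] elements, hence to meet each
[e i] in a single vertex ([minimal_cover_matching_edge]).

A fourth edge.  Let [x1] be in [f1 :&: e i] but not in [f2], and [x2] in
[f2 :&: e i] but not in [f1].  If no edge were contained in
[U = (f1 :\ x1) :|: (f2 :\ x2)], a minimal vertex cover inside the complement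
of [U] would meet [f1] only in [x1] and [f2] only in [x2], thus would contain
two vertices of [e i].  So some edge [h] lies in [U] ([exchange_edge]).

The cycle.  By the antichain property [h] contains some [z1] in [f1 :\: f2],
some [z2] in [f2 :\: f1], and some [w] outside [e i].  The edges [f1], [f2], [h]
and [e i] and the vertices [x1], [x2], [z1], [z2], [w] then contain a cycle of
length 3 or 4; which one depends on whether [z1] and [z2] are in [e i]. *)

Import GRing.Theory.

(** * Primes generated by variables *)

Section VariableIdeals.
Local Open Scope ring_scope.
Variables (K : fieldType) (n : nat).
Implicit Types (T : {set 'I_n}) (P : {mpoly K[n]} -> Prop) (p : {mpoly K[n]}).

Definition kill_vars T : n.-tuple {mpoly K[n]} :=
  [tuple if i \in T then 0 else 'X_i | i < n].

(** The ideal generated by the variables indexed by [T], seen as the kernel of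
the substitution of 0 for these variables, which makes its primality clear. *)
Definition var_ideal T p : Prop := p \mPo kill_vars T = 0.

Lemma kill_varsX T (i : 'I_n) :
  'X_i \mPo kill_vars T = if i \in T then 0 else 'X_i.
Proof. by rewrite comp_mpolyXU -tnth_nth tnth_mktuple. Qed.

Lemma var_idealX T (i : 'I_n) : var_ideal T 'X_i <-> i \in T.
Proof.
rewrite /var_ideal kill_varsX; case: (i \in T) => //; split=> // /eqP.
by rewrite -msize_poly_eq0 msizeX.
Qed.

Lemma var_ideal_prime T : prime_ideal (var_ideal T).
Proof.
split; first split; rewrite /var_ideal.
- exact: comp_mpoly0.
- by move=> u v u0 v0; rewrite comp_mpolyD u0 v0 addr0.
- by move=> a u u0; rewrite (rmorphM (comp_mpoly _)) /= u0 mulr0.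
- by rewrite comp_mpoly1 => /eqP; rewrite oner_eq0.
- move=> u v /eqP; rewrite (rmorphM (comp_mpoly _)) mulf_eq0 => /orP[] /eqP; by [left | right].
Qed.

(** Modulo an ideal containing the variables of [T], substituting 0 for them
changes nothing: the polynomials left unchanged modulo the ideal form a subring
which contains the constants and all variables. *)
Lemma kill_vars_congr P T p :
  ideal P -> (forall i, i \in T -> P 'X_i) -> P (p - (p \mPo kill_vars T)).
Proof.
case=> P0 PD PM PT.
have congrM a b : P (a - (a \mPo kill_vars T)) -> P (b - (b \mPo kill_vars T)) ->
    P (a * b - ((a * b) \mPo kill_vars T)).
  move=> Pa Pb; rewrite (rmorphM (comp_mpoly _)) /=.
  have -> : a * b - (a \mPo kill_vars T) * (b \mPo kill_vars T) =
    b * (a - (a \mPo kill_vars T)) + (a \mPo kill_vars T) * (b - (b \mPo kill_vars T)).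
    by rewrite !mulrBr [b * a]mulrC [b * _]mulrC addrA subrK.
  by apply: PD; apply: PM.
elim/mpolyind: p => [|c m p _ _ IHp]; first by rewrite comp_mpoly0 subr0.
rewrite comp_mpolyD comp_mpolyZ opprD addrACA; apply: PD => //.
rewrite -scalerBr -mul_mpolyC; apply: PM; rewrite mpolyXE_id.
elim/big_ind: _ => [||i _]; first by rewrite comp_mpoly1 subrr.
  exact: congrM.
elim: (m i) => [|k IHk]; first by rewrite expr0 comp_mpoly1 subrr.
rewrite exprS; apply: congrM => //; rewrite kill_varsX.
by case: ifP => [/PT|_]; rewrite ?subr0 ?subrr.
Qed.

Lemma var_ideal_sub P T :
  ideal P -> (forall i, i \in T -> P 'X_i) -> subideal (var_ideal T) P.
Proof.
by move=> idP PT p p0; have := kill_vars_congr P T p idP PT; rewrite p0 subr0.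
Qed.

(** A prime containing the variables of [S] has height at least [#|S|].  Putting
the prime itself, rather than [var_ideal S], at the top of the chain makes it
irrelevant whether the two coincide. *)
Lemma prime_chain_vars P (S : {set 'I_n}) :
  prime_ideal P -> (forall i, i \in S -> P 'X_i) -> prime_chain P #|S|.
Proof.
move=> primeP PS; have [idP _ _] := primeP.
pose T k := [set x in take k (enum S)].
exists (fun k => if (k < #|S|)%N then var_ideal (T k) else P); split.
- by move=> k _; case: ifP => // _; apply: var_ideal_prime.
- move=> k ltkS; rewrite ltkS.
  have ltk : (k < size (enum S))%N by rewrite -cardE.
  have [x0 _] : exists x, x \in S by apply/card_gt0P; apply: leq_ltn_trans ltkS.
  pose x := nth x0 (enum S) k.
  have Sx : x \in S by rewrite -mem_enum mem_nth.
  have TS i : i \in T k.+1 -> i \in S.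
    by rewrite inE => /mem_take; rewrite mem_enum.
  have TSk i : (i \in T k.+1) = (i == x) || (i \in T k).
    by rewrite !inE (take_nth x0) // mem_rcons inE.
  have Tx : x \notin T k.
    have := enum_uniq S; rewrite -(cat_take_drop k.+1 (enum S)) cat_uniq.
    by case/andP; rewrite (take_nth x0) // rcons_uniq inE => /andP[].
  split.
    apply: var_ideal_sub; case: ifP => // _.
    - by case: (var_ideal_prime (T k.+1)).
    - by move=> i Ti; apply/var_idealX; rewrite TSk Ti orbT.
    - by move=> i Ti; apply/PS/TS; rewrite TSk Ti orbT.
  move=> /(_ 'X_x) sub; move/negP: Tx; apply; apply/var_idealX/sub.
  by case: ifP => _; [apply/var_idealX; rewrite TSk eqxx | apply: PS].
- by move=> u; rewrite ltnn.
Qed.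

Lemma prime_edge_monomial P (e : {set 'I_n}) :
  prime_ideal P -> P (edge_monomial K e) -> exists2 i, i \in e & P 'X_i.
Proof.
case=> _ P1 PM; rewrite /edge_monomial => Pe.
apply: NNPP => noi; move: Pe; apply: (big_ind (fun p => ~ P p)) => //.
  by move=> a b Pa Pb /PM[].
by move=> i ei Pi; apply: noi; exists i.
Qed.

Lemma edge_idealX (C : clutter n) e :
  e \in edges C -> edge_ideal C (edge_monomial K e).
Proof.
move=> Ce; exists (fun f => (f == e)%:R).
rewrite (bigD1 e) //= eqxx mul1r big1 ?addr0 // => f /andP[_ /negbTE->].
by rewrite mul0r.
Qed.

(** A prime containing the monomial of an edge [e] contains some variable of [e],
so the variables of a prime over the edge ideal index a cover, and
[prime_chain_vars] bounds their number by the height of that prime. *)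
Lemma cover_of_height (C : clutter n) (g : nat) :
  height (@edge_ideal n C K) g ->
  exists2 S : {set 'I_n}, vertex_cover C S & (#|S| <= g)%N.
Proof.
case=> [[P [primeP subP [_ maxP]]] _].
have [b bP] : exists b : 'I_n -> bool, forall i, b i <-> P 'X_i.
  apply: (fin_all_exists (P := fun i (c : bool) => c <-> P 'X_i)) => i.
  by case: (classic (P 'X_i)) => Pi; [exists true | exists false].
exists [set i | b i].
  apply/forall_inP => e Ce; apply/set0Pn.
  have [i ei Pi] := prime_edge_monomial _ _ primeP (subP _ (edge_idealX _ _ Ce)).
  by exists i; rewrite !inE ei andbT; apply/bP.
by apply/maxP/prime_chain_vars => // i; rewrite inE => /bP.
Qed.

End VariableIdeals.

(** * Minimal covers of an unmixed clutter with a König matching *)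

Section Covers.
Variables (n : nat) (C : clutter n).

Lemma vertex_coverP (S : {set 'I_n}) :
  reflect (forall e, e \in edges C -> exists2 x, x \in S & x \in e)
          (vertex_cover C S).
Proof.
apply: (iffP forall_inP) => covS e Ce.
  by have /set0Pn[x] := covS e Ce; rewrite inE => /andP[]; exists x.
by have [x Sx ex] := covS e Ce; apply/set0Pn; exists x; rewrite inE Sx.
Qed.

(** Choosing a covering vertex in each of the [g] disjoint edges is injective, so
the chosen vertices already exhaust [S]. *)
Lemma small_cover_matching_edge (g : nat) (e : 'I_g -> {set 'I_n})
    (S : {set 'I_n}) (i : 'I_g) (x y : 'I_n) :
  (forall j, e j \in edges C) -> (forall j k, j != k -> [disjoint e j & e k]) ->
  vertex_cover C S -> #|S| <= g ->
  x \in S -> x \in e i -> y \in S -> y \in e i -> x = y.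
Proof.
move=> Ce dis /vertex_coverP covS leSg Sx ex Sy ey.
have [c cP] : exists c : 'I_g -> 'I_n, forall j, c j \in S :&: e j.
  apply: (fin_all_exists (P := fun j z => z \in S :&: e j)) => j; have [z Sz ez] := covS _ (Ce j).
  by exists z; rewrite inE Sz.
have same j k z : z \in e j -> z \in e k -> j = k.
  move=> ej ek; apply/eqP; apply: contraT => /dis /disjointFr/(_ ej).
  by rewrite ek.
have cinj : injective c.
  move=> j k cjk; have := cP j; have := cP k; rewrite cjk !inE.
  by case/andP=> _ ck /andP[_]; move/same; apply.
have imc : c @: setT = S.
  apply/eqP; rewrite eqEcard card_imset // cardsT card_ord leSg andbT.
  by apply/subsetP => z /imsetP[j _ ->]; have := cP j; rewrite inE => /andP[].
have only z : z \in S -> z \in e i -> z = c i.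
  rewrite -imc => /imsetP[j _ ->] cji; have := cP j; rewrite inE => /andP[_ cjj].
  by rewrite (same _ _ _ cji cjj).
by rewrite (only x) // (only y).
Qed.

Lemma minimal_cover_matching_edge (K : fieldType) (g : nat)
    (e : 'I_g -> {set 'I_n}) (D : {set 'I_n}) (i : 'I_g) (x y : 'I_n) :
  konig_perfect_matching C K e -> unmixed C -> minimal_vertex_cover C D ->
  x \in D -> x \in e i -> y \in D -> y \in e i -> x = y.
Proof.
case=> Ce dis _ /cover_of_height[S covS leSg] unm minD.
apply: small_cover_matching_edge (minsetp minD) _ => //.
have [S' minS' subS'] := minset_exists covS.
by rewrite (unm _ _ minD minS') (leq_trans (subset_leq_card subS')).
Qed.

(** Otherwise the complement of the union would be a cover, and any minimal
cover inside it would have to use [x1] for [f1] and [x2] for [f2]. *)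
Lemma exchange_edge (K : fieldType) (g : nat) (e : 'I_g -> {set 'I_n})
    (i : 'I_g) (f1 f2 : {set 'I_n}) (x1 x2 : 'I_n) :
  konig_perfect_matching C K e -> unmixed C ->
  f1 \in edges C -> f2 \in edges C -> x1 != x2 ->
  x1 \in e i -> x2 \in e i ->
  exists2 h, h \in edges C & h \subset (f1 :\ x1) :|: (f2 :\ x2).
Proof.
move=> he unm Cf1 Cf2 x12 ex1 ex2; set U := _ :|: _.
case: (boolP [exists h in edges C, h \subset U]) => [/exists_inP[h]|noh].
  by exists h.
have covU : vertex_cover C (~: U).
  apply/vertex_coverP => h Ch; move/exists_inPn: noh => /(_ h Ch) /subsetPn.
  by case=> z hz Uz; exists z; rewrite // inE.
have [D minD subD] := minset_exists covU.
have /vertex_coverP covD := minsetp minD.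
have Dx1 : x1 \in D.
  have [z Dz fz] := covD _ Cf1; move/subsetP: subD => /(_ z Dz).
  by rewrite !inE fz andbT negb_or negbK => /andP[/eqP<-].
have Dx2 : x2 \in D.
  have [z Dz fz] := covD _ Cf2; move/subsetP: subD => /(_ z Dz).
  by rewrite !inE fz andbT negb_or negbK => /andP[_ /eqP<-].
case/eqP: x12.
exact: (minimal_cover_matching_edge K g e D i x1 x2 he unm minD).
Qed.

End Covers.

(** * Short cycles *)

Section Cycles.
Variables (n : nat) (C : clutter n).

(** For [2 < r], the [r] pairs of cyclically consecutive indices are distinct;
for [r = 2] they all coincide. *)
Lemma ordS_pair_inj r (j k : 'I_r) : 2 < r ->
  [set j; ordS j] = [set k; ordS k] -> j = k.
Proof.
move=> lt2r eqjk; have := set21 j (ordS j); have := set21 k (ordS k).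
rewrite {1}eqjk -{1}eqjk !inE => /orP[/eqP-> //|/eqP kj] /orP[/eqP//|/eqP jk].
have /(congr1 val)/= jSS : j = ordS (ordS j) by rewrite -kj.
have : j + 2 == j + 0 %[mod r].
  by rewrite addn0 {2}jSS modn_mod -[_.+1 in X in _ == X]addn1 modnDml addn1 addn2.
by rewrite eqn_modDl mod0n modn_small.
Qed.

Lemma ordS_neq r (j : 'I_r) : 1 < r -> j != ordS j.
Proof.
move=> lt1r; apply: contraTneq isT => /(congr1 val)/= jS.
have : j + 1 == j + 0 %[mod r] by rewrite addn0 {2}jS modn_mod addn1.
by rewrite eqn_modDl mod0n modn_small.
Qed.

(** The distinctness of the chosen vertices and edges comes for free: different
rows, and different columns, of the cyclic pattern are different. *)
Lemma has_cycle_cyclic r (v : 'I_r -> 'I_n) (F : 'I_r -> {set 'I_n}) :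
  2 < r -> (forall k, F k \in edges C) ->
  (forall j k, (v j \in F k) = (k == j) || (k == ordS j)) -> has_cycle C r.
Proof.
move=> lt2r CF vF; split=> //.
have lt1r := ltnW lt2r.
have rowE j : [set k | v j \in F k] = [set j; ordS j].
  by apply/setP => k; rewrite !inE vF.
have colE k : [set j | v j \in F k] = [set ord_pred k; k].
  apply/setP => j; rewrite !inE vF orbC eq_sym [k == j]eq_sym.
  by rewrite (can2_eq (@ordSK r) (@ord_predK r)).
have mxE j k : (mxsub v (fun k => enum_rank_in (CF k) (F k))
                 (incidence_mx C) j k == 1%R) = (v j \in F k).
  by rewrite !mxE enum_rankK_in //; case: (_ \in _).
exists v, (fun k => enum_rank_in (CF k) (F k)); split.
- by move=> j k vjk; apply: ordS_pair_inj => //; rewrite -!rowE vjk.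
- move=> j k /(congr1 enum_val); rewrite !enum_rankK_in // => Fjk.
  apply/ord_pred_inj/ordS_pair_inj => //.
  by rewrite !ord_predK -!colE Fjk.
- move=> j; rewrite -[RHS](_ : #|[set j; ordS j]| = 2); last first.
    by rewrite cards2 ordS_neq.
  by rewrite -rowE; apply: eq_card => k; rewrite !inE mxE.
- move=> k; rewrite -[RHS](_ : #|[set ord_pred k; k]| = 2); last first.
    by rewrite -{2}[k]ord_predK cards2 ordS_neq.
  by rewrite -colE; apply: eq_card => j; rewrite !inE mxE.
Qed.

Lemma has_cycle3 (A B D : {set 'I_n}) (x y z : 'I_n) :
  A \in edges C -> B \in edges C -> D \in edges C ->
  x \in A :&: B :\: D -> y \in B :&: D :\: A -> z \in D :&: A :\: B ->
  has_cycle C 3.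
Proof.
move=> CA CB CD; rewrite !inE.
move=> /and3P[/negbTE xD xA xB] /and3P[/negbTE yA yB yD] /and3P[/negbTE zB zD zA].
apply: (has_cycle_cyclic 3 (tnth [tuple x; y; z]) (tnth [tuple A; B; D])) => //.
  by case=> [[|[|[|]]]].
case=> [[|[|[|//]]] ?]; case=> [[|[|[|//]]] ?]; by rewrite !(tnth_nth x, tnth_nth A).
Qed.

Lemma has_cycle4 (A B D E : {set 'I_n}) (x y z t : 'I_n) :
  A \in edges C -> B \in edges C -> D \in edges C -> E \in edges C ->
  x \in A :&: B :\: (D :|: E) -> y \in B :&: D :\: (E :|: A) ->
  z \in D :&: E :\: (A :|: B) -> t \in E :&: A :\: (B :|: D) ->
  has_cycle C 4.
Proof.
move=> CA CB CD CE; rewrite !inE !negb_or -!andbA.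
move=> /and4P[/negbTE xD /negbTE xE xA xB] /and4P[/negbTE yE /negbTE yA yB yD].
move=> /and4P[/negbTE zA /negbTE zB zD zE] /and4P[/negbTE tB /negbTE tD tE tA].
apply: (has_cycle_cyclic 4 (tnth [tuple x; y; z; t]) (tnth [tuple A; B; D; E])) => //.
  by case=> [[|[|[|[|]]]]].
case=> [[|[|[|[|//]]]] ?]; case=> [[|[|[|[|//]]]] ?];
  by rewrite !(tnth_nth x, tnth_nth A).
Qed.

End Cycles.

Theorem theorem2p12 (K : fieldType) (n : nat) (C : clutter n)
    (g : nat) (e : 'I_g -> {set 'I_n})
    (he : konig_perfect_matching C K e)
    (h3 : ~ has_cycle C 3) (h4 : ~ has_cycle C 4)
    (hunmixed : unmixed C)
    (f1 f2 : {set 'I_n}) (hf1 : f1 \in edges C) (hf2 : f2 \in edges C)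
    (i : 'I_g) :
  (f1 :&: e i \subset f2 :&: e i) \/ (f2 :&: e i \subset f1 :&: e i).
Proof.
apply/orP; apply: contraT; rewrite negb_or => /andP[].
case/subsetPn=> x1; rewrite !inE => /andP[x1f1 x1e]; rewrite x1e andbT => x1f2.
case/subsetPn=> x2; rewrite !inE => /andP[x2f2 x2e]; rewrite x2e andbT => x2f1.
have Ce : e i \in edges C by case: he.
have x12 : x1 != x2 by apply: contraNneq x1f2 => ->.
have [h Ch subh] :=
  exchange_edge n C K g e i f1 f2 x1 x2 he hunmixed hf1 hf2 x12 x1e x2e.
have hU z : z \in h -> (z != x1) && (z \in f1) || (z != x2) && (z \in f2).
  by move=> hz; have := subsetP subh z hz; rewrite !inE.
have x1h : x1 \notin h.
  by apply/negP => /hU; rewrite eqxx (negbTE x1f2) andbF.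
have x2h : x2 \notin h.
  by apply/negP => /hU; rewrite eqxx (negbTE x2f1) andbF.
have notsub f x : f \in edges C -> x \in f -> x \notin h ->
    exists2 z, z \in h & z \notin f.
  move=> Cf xf xh; apply/subsetPn; apply: contra xh => hf.
  by rewrite (edges_antichain Ch Cf hf).
have [z1 z1h z1f2] := notsub f2 x2 hf2 x2f2 x2h.
have [z2 z2h z2f1] := notsub f1 x1 hf1 x1f1 x1h.
have [w wh we] := notsub (e i) x1 Ce x1e x1h.
have z1f1 : z1 \in f1 by have := hU z1 z1h; rewrite (negbTE z1f2) andbF orbF => /andP[].
have z2f2 : z2 \in f2 by have := hU z2 z2h; rewrite (negbTE z2f1) andbF => /andP[].
case: (boolP (z1 \in e i)) => z1e; case: (boolP (z2 \in e i)) => z2e.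
(* If [w] is in both [f1] and [f2], it closes a triangle with [x1] and [x2];
   otherwise it takes the place of the one of [z1], [z2] on its side, but is
   outside [e i]. *)
- case: (boolP (w \in f1)) => wf1; case: (boolP (w \in f2)) => wf2.
  + case: h3; apply: (has_cycle3 n C f1 f2 (e i) w x2 x1) => //;
      by rewrite !inE; apply/and3P.
  + case: h3; apply: (has_cycle3 n C f1 h (e i) w z2 x1) => //;
      by rewrite !inE; apply/and3P.
  + case: h3; apply: (has_cycle3 n C f2 h (e i) w z1 x2) => //;
      by rewrite !inE; apply/and3P.
  + by have := hU w wh; rewrite (negbTE wf1) (negbTE wf2) !andbF.
- case: h3; apply: (has_cycle3 n C f2 h (e i) z2 z1 x2) => //;
    by rewrite !inE; apply/and3P.
- case: h3; apply: (has_cycle3 n C f1 h (e i) z1 z2 x1) => //;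
    by rewrite !inE; apply/and3P.
- case: h4; apply: (has_cycle4 n C f1 h f2 (e i) z1 z2 x2 x1) => //;
    by rewrite !inE negb_or -!andbA; apply/and4P.
Qed.
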